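(* Let $q\geq3$ and let $x,y$ be vertices of the Farey graph $\mathcal{F}_q$. Every path in $\mathcal{F}_q$ between $x$ and $y$ passes through one of the $y$-parents of $x$.
   Context: $\mathbb{R}_\infty=\mathbb{R}\cup\{\infty\}$. Let $\lambda_q=2\cos(\pi/q)$, $G_q$ the group generated by $\sigma(z)=-1/z$ and $\tau(z)=z+\lambda_q$, $\rho(z)=\lambda_q-1/z$. The Farey graph $\mathcal{F}_q$ has vertex set $G_q(\infty)$, $u,v$ adjacent iff $\{u,v\}=\{g(0),g(\infty)\}$ for some $g\in G_q$; faces are the ideal $q$-gons $g(E)$, $g\in G_q$, with $E$ the ideal $q$-gon with vertices $\rho^i(\infty)$, $i=0,\dots,q-1$. A path is a vertex sequence with consecutive vertices adjacent. $y$-parents: if $x=y$ or $x\sim y$, the (single) $y$-parent of $x$ is $y$. Otherwise there is a unique face $P$ with vertex $x$ such that, if $u,v$ are the two vertices of $P$ adjacent to $x$, then $y$ lies in the component of $\mathbb{R}_\infty\setminus\{u,v\}$ not containing $x$; the $y$-parents of $x$ are $u$ and $v$. *)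

(* Defs.v *)
From HB Require Import structures.
From mathcomp Require Import all_boot all_order all_algebra.
From mathcomp Require Import all_classical all_reals all_analysis.
Import Order.TTheory GRing.Theory Num.Theory.
Import numFieldNormedType.Exports.
Set Implicit Arguments.
Unset Strict Implicit.
Unset Printing Implicit Defensive.
Local Open Scope classical_set_scope.
Local Open Scope ring_scope.

(* The circle R_oo = R \cup {oo}, with its usual topology; oo is [None]. *)
Notation Rinf R := (one_point_compactification R).

Inductive generated (T : Type) (S : set (T -> T)) : set (T -> T) :=
| generated_gen f : S f -> generated S f
| generated_id : generated S idfun
| generated_comp f g : generated S f -> generated S g -> generated S (f \o g)
| generated_inv f g :
    generated S f -> cancel f g -> cancel g f -> generated S g.

Section Farey.
Variables (R : realType) (q : nat).

Definition hecke_lambda : R := 2 * cos (pi / q%:R).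

Definition infty : Rinf R := None.
Definition zero : Rinf R := Some 0.

Definition sigma (z : Rinf R) : Rinf R :=
  if z is Some t then (if t == 0 then infty else Some (- t^-1)) else zero.

Definition tau (z : Rinf R) : Rinf R :=
  if z is Some t then Some (t + hecke_lambda) else infty.

(* z |-> lambda_q - 1/z *)
Definition rho : Rinf R -> Rinf R := tau \o sigma.

(* G_q is represented by its action on R_oo, which is faithful: a Moebius
   transformation is determined by its restriction to R_oo. *)
Definition hecke : set (Rinf R -> Rinf R) := generated [set sigma; tau].

Definition farey_vertex : set (Rinf R) := [set g infty | g in hecke].

Definition farey_adj (u v : Rinf R) : Prop :=
  exists2 g, hecke g & [set u; v] = [set g zero; g infty].

Definition base_polygon : set (Rinf R) :=
  [set iter i rho infty | i in [set i | (i < q)%N]].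

(* An ideal polygon is the hyperbolic convex hull of its ideal vertices, hence
   is determined by them; a face is represented by its set of vertices. *)
Definition farey_face : set (set (Rinf R)) := [set g @` base_polygon | g in hecke].

(* P is a face with vertex x and, u and v being the two vertices of P adjacent
   to x, y lies in a component of R_oo \ {u, v} that does not contain x. The
   component of y is empty when y is u or v, hence the separate condition. *)
Definition parent_face (y x : Rinf R) (P : set (Rinf R)) : Prop :=
  [/\ farey_face P, P x &
      exists u v, [/\ u <> v, P `&` farey_adj x = [set u; v],
        (~` [set u; v]) y & ~ connected_component (~` [set u; v]) y x]].

(* In the second case the parents of x are taken in "the"
   face P of [parent_face], so its uniqueness is part of the definition. *)
Definition parents (y x : Rinf R) : set (Rinf R) := [set p |
     (x = y \/ farey_adj x y) /\ p = y
  \/ ~ (x = y \/ farey_adj x y) /\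
     exists P, [/\ unique (parent_face y x) P, P p & farey_adj x p]].

(* The vertex sequence x :: s is a path of the Farey graph from x to y. *)
Definition farey_path (x : Rinf R) (s : seq (Rinf R)) (y : Rinf R) : Prop :=
  path (fun u v => `[< farey_adj u v >]) x s /\ last x s = y.

End Farey.

(* Main.v *)
Require Import Defs.
From HB Require Import structures.
From mathcomp Require Import all_boot all_order all_algebra.
From mathcomp Require Import all_classical all_reals all_analysis.
From mathcomp Require Import ring lra.
Import Order.TTheory GRing.Theory Num.Theory.
Import numFieldNormedType.Exports.
Local Open Scope classical_set_scope.
Local Open Scope ring_scope.

(* The map phi |-> sin(phi + pi/q) / sin phi conjugates rho to the translation
   phi |-> phi + pi/q (mod pi).  Hence, for 0 < i < q, rho^i maps the arc
   [oo, 0] into [lambda_q, oo] (i = 1) or into [0, lambda_q] (i > 1), while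
   sigma maps both of these into [oo, 0].  A ping-pong argument on words in
   sigma and rho then shows that every edge lies in one of these three arcs, and
   so does every face other than the base polygon E.  After moving x to oo by
   G_q, and then y into (0, lambda_q) by a power of tau, the parent face can only
   be E, the parents are 0 and lambda_q, and no edge leaves the open arc
   (0, lambda_q) except at its endpoints. *)

Set Implicit Arguments.
Unset Strict Implicit.

(** * Angle coordinate on the circle, arcs, and the base polygon *)

Section HeckeGroup.
Variables (R : realType) (q : nat).
Hypothesis hq : (3 <= q)%N.

Local Notation lam := (hecke_lambda R q).
Local Notation oo := (infty R).
Local Notation O := (Defs.zero R).
Local Notation sigma := (@sigma R).
Local Notation rho := (@rho R q).
Local Notation theta := (pi / q%:R : R).

Lemma thetaMq : theta * q%:R = pi.
Proof. by rewrite divfK// pnatr_eq0 -lt0n; exact: leq_trans hq. Qed.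

Lemma theta_gt0 : 0 < theta.
Proof. by rewrite divr_gt0 ?pi_gt0// ltr0n; exact: leq_trans hq. Qed.

Lemma theta_le : theta <= pi / 3.
Proof.
by rewrite ler_pM2l ?pi_gt0// lef_pV2 ?posrE ?ltr0n// ?ler_nat//; exact: leq_trans hq.
Qed.

Lemma hecke_lambda_gt0 : 0 < lam.
Proof.
rewrite mulr_gt0// cos_gt0_pihalf//.
by have := theta_le; have := theta_gt0; have := pi_gt0 R; lra.
Qed.

Lemma sin_theta_gt0 : 0 < sin theta.
Proof.
rewrite sin_gt0_pi//.
by have := theta_le; have := theta_gt0; have := pi_gt0 R; lra.
Qed.

(** The quotient is cos theta + sin theta cot a, so [a] modulo pi is a coordinate on the whole
    circle, with a = 0 at infinity. *)
Definition angle_pt (a : R) : Rinf R :=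
  if sin a == 0 then None else Some (sin (a + theta) / sin a).

(** Sum-to-product gives sin(a + 2 theta) = lambda_q sin(a + theta) - sin a; dividing by sin(a +
    theta) yields lambda_q - 1/z. *)
Lemma rho_angle_pt a : rho (angle_pt a) = angle_pt (a + theta).
Proof.
have c2 : sin (a + theta + theta) = lam * sin (a + theta) - sin a.
  rewrite /hecke_lambda (_ : a + theta + theta = theta + (a + theta)); last by ring.
  rewrite [in LHS]sinD [in X in _ - X](_ : a = (a + theta) - theta); last by ring.
  by rewrite sinB; ring.
have st := sin_theta_gt0.
rewrite /angle_pt /Defs.rho /=; have [sa|sa] := eqVneq (sin a) 0.
  have sat : sin (a + theta) != 0.
    rewrite sinD sa mul0r add0r mulf_neq0//; last by rewrite gt_eqF.
    have /eqP := cos2Dsin2 a; rewrite sa expr0n addr0; apply: contraL => /eqP ->.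
    by rewrite expr0n eq_sym oner_neq0.
  by rewrite /= (negbTE sat) add0r c2 sa subr0 mulfK.
have [sat|sat] := eqVneq (sin (a + theta)) 0; first by rewrite /= sat mul0r eqxx.
rewrite /= mulf_eq0 invr_eq0 (negbTE sat) (negbTE sa)/= c2.
by congr Some; field; rewrite sa sat.
Qed.

Lemma iter_rho_angle_pt n a :
  iter n rho (angle_pt a) = angle_pt (a + n%:R * theta).
Proof.
elim: n => [|n IH] /=; first by rewrite mul0r addr0.
by rewrite IH rho_angle_pt; congr angle_pt; rewrite -[n.+1]addn1 natrD; ring.
Qed.

Lemma angle_ptDpi a : angle_pt (a + pi) = angle_pt a.
Proof.
by rewrite /angle_pt addrAC !sinDpi oppr_eq0 invrN mulrNN.
Qed.

Lemma angle_pt0 : angle_pt 0 = oo.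
Proof. by rewrite /angle_pt sin0 eqxx. Qed.

Lemma angle_ptNtheta : angle_pt (- theta) = O.
Proof.
by rewrite /angle_pt sinN oppr_eq0 gt_eqF ?sin_theta_gt0// addNr sin0 mul0r.
Qed.

Lemma angle_pt_surj z : exists2 a, 0 <= a < pi & angle_pt a = z.
Proof.
have st := sin_theta_gt0; case: z => [t|]; last first.
  by exists 0; rewrite ?lexx ?pi_gt0// angle_pt0.
(* The angle must satisfy cot a = (t - cos theta) / sin theta; with a = pi/2 - b this becomes an
   equation for tan b. *)
set b := atan ((t - cos theta) / sin theta).
have b1 : - (pi / 2) < b := atan_gtNpi2 _.
have b2 : b < pi / 2 := atan_ltpi2 _.
exists (pi / 2 - b); first lra.
have cb : 0 < cos b by rewrite cos_gt0_pihalf// b1.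
have tb : sin b = (t - cos theta) / sin theta * cos b.
  by rewrite -[X in X * _]atanK -/b /tan divfK// gt_eqF.
have sa : sin (pi / 2 - b) = cos b by rewrite -cosN -sinDpihalf; congr sin; ring.
have ca : cos (pi / 2 - b) = sin b by rewrite -[b in RHS]opprK sinN -cosDpihalf; congr cos; ring.
rewrite /angle_pt sinD sa ca gt_eqF// tb; congr Some.
by field; rewrite !gt_eqF.
Qed.

Lemma iter_rho_q z : iter q rho z = z.
Proof.
have [a _ <-] := angle_pt_surj z.
by rewrite iter_rho_angle_pt mulrC thetaMq angle_ptDpi.
Qed.

Definition neg_arc : set (Rinf R) :=
  [set z | if z is Some t then t <= 0 else True].
Definition far_arc : set (Rinf R) :=
  [set z | if z is Some t then lam <= t else True].
Definition mid_arc : set (Rinf R) :=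
  [set z | if z is Some t then 0 <= t <= lam else False].

Lemma neg_arc_angle z : neg_arc z -> exists2 a, - theta <= a <= 0 & angle_pt a = z.
Proof.
have t0 := theta_gt0; have [a /andP[a0 api] <-] := angle_pt_surj z.
have [->|a_neq0] := eqVneq a 0.
  by exists 0; rewrite ?lexx ?oppr_le0 ?andbT// ltW.
have sa : 0 < sin a by rewrite sin_gt0_pi// api andbT lt_def a_neq0.
rewrite /neg_arc /= {1}/angle_pt gt_eqF// pmulr_lle0 ?invr_gt0// => sat.
(* Since sin(a + theta) <= 0 forces a >= pi - theta, subtracting the period pi lands in
   [-theta, 0]. *)
exists (a - pi); last by rewrite -angle_ptDpi subrK.
rewrite subr_le0 (ltW api) andbT leNgt; apply/negP => lt.
by move: sat; apply/negP; rewrite -ltNge sin_gt0_pi//; lra.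
Qed.

Lemma mid_arc_angle a : theta <= a <= pi - theta -> mid_arc (angle_pt a).
Proof.
move=> /andP[ta at']; have t0 := theta_gt0.
have sa : 0 < sin a by rewrite sin_gt0_pi//; lra.
rewrite /mid_arc /= /angle_pt gt_eqF// divr_ge0 ?(ltW sa)//=; last first.
  by rewrite sin_ge0_pi//; lra.
rewrite ler_pdivrMr// /hecke_lambda sinD.
(* The upper bound amounts to this sign, because lambda_q sin a - sin(a + theta) = sin(a -
   theta). *)
have : 0 <= sin (a - theta) by rewrite sin_ge0_pi//; lra.
by rewrite sinB; lra.
Qed.

Lemma rho_neg_arc z : neg_arc z -> far_arc (rho z).
Proof.
case: z => [t|_]; rewrite /far_arc /Defs.rho /=; last by rewrite add0r.
by case: ifP => //= _ t0; rewrite lerDr oppr_ge0 invr_le0.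
Qed.

(** Angles in [-theta, 0] are shifted by i theta with 2 <= i <= q - 1, hence into
    [theta, (q - 1) theta] = [theta, pi - theta]. *)
Lemma iter_rho_neg_arc i z : (1 < i < q)%N -> neg_arc z -> mid_arc (iter i rho z).
Proof.
move=> /andP[i1 iq] /neg_arc_angle[a /andP[a1 a2] <-].
have t0 := theta_gt0; rewrite iter_rho_angle_pt; apply: mid_arc_angle.
have h1 : 2 * theta <= i%:R * theta by rewrite ler_pM2r// ler_nat.
have h2 : (i%:R + 1) * theta <= q%:R * theta.
  by rewrite ler_pM2r// natr1 ler_nat.
by move: h2; rewrite [q%:R * _]mulrC thetaMq mulrDl mul1r; lra.
Qed.

Lemma sigma_sigma : cancel sigma sigma.
Proof.
case=> [t|] /=; last by rewrite eqxx.
have [->|t0] //= := eqVneq t 0.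
by rewrite oppr_eq0 invr_eq0 (negbTE t0) invrN opprK invrK.
Qed.

Lemma sigma_neg_arc z : far_arc z \/ mid_arc z -> neg_arc (sigma z).
Proof.
have l0 := hecke_lambda_gt0.
case: z => [t|_] //= h; have t0 : 0 <= t.
  by case: h => [/(le_trans (ltW l0))//|/andP[]].
by case: ifP => //= _; rewrite /neg_arc/= oppr_le0 invr_ge0.
Qed.

Lemma base_polygonP z : base_polygon q z -> z = oo \/ mid_arc z.
Proof.
have t0 := theta_gt0.
move=> [i /= iq <-]; rewrite -angle_pt0 iter_rho_angle_pt add0r.
case: i iq => [|i iq]; first by rewrite mul0r; left.
right; apply: mid_arc_angle.
have h1 : 1 * theta <= i.+1%:R * theta by rewrite ler_pM2r// ler1n.
have h2 : (i.+1%:R + 1) * theta <= q%:R * theta by rewrite ler_pM2r// natr1 ler_nat.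
by move: h1 h2; rewrite [q%:R * _]mulrC thetaMq mulrDl mul1r; lra.
Qed.

Lemma base_polygon_oo : base_polygon q oo.
Proof. by exists 0%N => //=; exact: leq_trans hq. Qed.

Lemma base_polygon_lambda : base_polygon q (Some lam).
Proof.
by exists 1%N; [exact: leq_trans hq | rewrite /Defs.rho /= add0r].
Qed.

Lemma base_polygon_zero : base_polygon q O.
Proof.
(* This vertex has angle (q - 1) theta = pi - theta, which modulo pi is -theta, the angle of 0. *)
exists q.-1; first by rewrite /= prednK//; exact: leq_trans hq.
rewrite -angle_ptNtheta -angle_pt0 iter_rho_angle_pt -[RHS]angle_ptDpi add0r.
rewrite -subn1 natrB; last exact: leq_trans hq.
by rewrite mulrBl mul1r [_ * theta]mulrC thetaMq; congr angle_pt; ring.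
Qed.

Lemma iter_rho_base_polygon i : iter i rho @` base_polygon q = base_polygon q.
Proof.
have modq n : iter n rho oo = iter (n %% q) rho oo.
  rewrite [in LHS](divn_eq n q) addnC iterD; congr (iter _ _ _).
  by elim: (n %/ q)%N => //= m IH; rewrite mulSn iterD IH iter_rho_q.
have q0 : (0 < q)%N by exact: leq_trans hq.
apply/seteqP; split=> z.
  by move=> [_ [j _ <-] <-]; rewrite -iterD modq; exists ((i + j) %% q)%N => //=; rewrite ltn_mod.
(* Here i (q - 1) stands for -i modulo q, the order of [rho]. *)
move=> [j _ <-]; exists (iter ((i * (q - 1) + j) %% q) rho oo).
  by exists ((i * (q - 1) + j) %% q)%N => //=; rewrite ltn_mod.
rewrite -modq -iterD addnA -{1}(muln1 i) -mulnDr subnKC//.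
by rewrite modq modnMDl -modq.
Qed.

End HeckeGroup.

(** * Words in [sigma] and [rho], and ping-pong on the arcs *)

Section NormalForm.
Variables (R : realType) (q : nat).
Hypothesis hq : (3 <= q)%N.

Local Notation oo := (infty R).
Local Notation O := (Defs.zero R).
Local Notation sigma := (@sigma R).
Local Notation tau := (@tau R q).
Local Notation rho := (@rho R q).
Local Notation E := (@base_polygon R q).
Local Notation far_arc := (@far_arc R q).
Local Notation mid_arc := (@mid_arc R q).
Local Notation neg_arc := (@neg_arc R).

(* The free product decomposition of G_q: the Boolean records whether the
   leftmost syllable is a nontrivial power of rho. *)
Inductive syllables : bool -> (Rinf R -> Rinf R) -> Prop :=
| syllables_id : syllables false idfun
| syllables_sigma : syllables false sigma
| syllables_cons_rho i g : (0 < i < q)%N -> syllables false g ->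
    syllables true (iter i rho \o g)
| syllables_cons_sigma g : syllables true g -> syllables false (sigma \o g).

Definition has_syllables g := exists b, syllables b g.

Lemma has_syllables_sigma g : has_syllables g -> has_syllables (sigma \o g).
Proof.
have ss : sigma \o sigma = idfun by apply/funext; exact: sigma_sigma.
move=> [b [||i h iq hh|h hh]].
- by exists false; exact: syllables_sigma.
- by rewrite ss; exists false; exact: syllables_id.
- by exists false; apply: syllables_cons_sigma; exact: syllables_cons_rho.
- by rewrite compA ss; exists true.
Qed.

Lemma has_syllables_rho g : has_syllables g -> has_syllables (rho \o g).
Proof.
have step h : syllables false h -> has_syllables (rho \o h).
  by move=> hh; exists true; apply: (@syllables_cons_rho 1) => //; exact: ltnW.
move=> [b [||i h /andP[i0 iq] hh|h hh]].
- by apply: step; exact: syllables_id.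
- by apply: step; exact: syllables_sigma.
(* Either the leading power of [rho] reaches rho^q = id and disappears, exposing [h], or its
   exponent grows by one. *)
- have [e|ne] := eqVneq i.+1 q.
    exists false; rewrite (_ : _ \o _ = h)//; apply/funext => z /=.
    by rewrite -iterS e iter_rho_q.
  exists true; apply: (@syllables_cons_rho i.+1) => //=.
  by rewrite ltn_neqAle ne.
- by apply: step; exact: syllables_cons_sigma.
Qed.

Lemma hecke_has_syllables g : hecke q g -> has_syllables g.
Proof.
(* An equivalence, rather than one implication, lets the induction pass through the inverse
   constructor. *)
suff H f : hecke q f -> forall h, has_syllables (f \o h) <-> has_syllables h.
  move=> /H /(_ idfun) [_]; apply.
  by exists false; exact: syllables_id.
have Hs h : has_syllables (sigma \o h) <-> has_syllables h.
  split; last exact: has_syllables_sigma.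
  move/has_syllables_sigma; rewrite compA (_ : _ \o sigma = idfun)//.
  by apply/funext; exact: sigma_sigma.
have Hr h : has_syllables (rho \o h) <-> has_syllables h.
  split; last exact: has_syllables_rho.
  have Hn n k : has_syllables k -> has_syllables (iter n rho \o k).
    by elim: n => [|n IH]//= /IH /has_syllables_rho.
  move/(Hn q.-1); rewrite compA (_ : _ \o rho = idfun)//.
  apply/funext => z /=; rewrite -iterSr prednK ?iter_rho_q//.
  exact: leq_trans hq.
elim=> {f} [f [->|->]||f1 f2 _ Hf _ Hg|f f' _ Hf ff' f'f] h.
- exact: Hs.
- rewrite (_ : tau = rho \o sigma); last first.
    by apply/funext => z; rewrite /Defs.rho /= sigma_sigma.
  by rewrite -compA Hr Hs.
- by [].
- by rewrite -compA Hf Hg.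
- by rewrite -Hf compA (_ : f \o f' = idfun)//; exact/funext.
Qed.

Definition in_one_arc (X : set (Rinf R)) :=
  [\/ X `<=` neg_arc, X `<=` far_arc | X `<=` mid_arc].

(** Ping-pong for edges and faces at once. A power of [rho] sends the negative arc to the far arc
    (exponent 1) or the middle arc (larger exponents), and [sigma] sends both back. Powers of [rho]
    preserve [E] until a [sigma] throws it into the negative arc; from then on its image behaves
    like an edge. *)
Lemma syllables_arc b g (X := [set g O; g oo]) : syllables b g ->
  if b then
    (X `<=` far_arc \/ X `<=` mid_arc) /\
    [\/ g @` E = E, g @` E `<=` far_arc | g @` E `<=` mid_arc]
  else X `<=` neg_arc /\ (g @` E = E \/ g @` E `<=` neg_arc).
Proof.
rewrite {}/X; elim=> {b g} [||i g /andP[i0 iq] _ [IH1 IH2]|g _ [IH1 IH2]].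
- split; first by move=> z [->|->] //=; rewrite /neg_arc/= ?lexx.
  by left; rewrite image_id.
- split.
    by move=> z [->|->] //=; rewrite ?eqxx /neg_arc/= ?lexx.
  right=> _ [z /(base_polygonP hq) [->|h] <-].
    by rewrite /neg_arc /= lexx.
  by apply: (sigma_neg_arc hq); right.
- have arcs (X : set (Rinf R)) : X `<=` neg_arc ->
      iter i rho @` X `<=` far_arc \/ iter i rho @` X `<=` mid_arc.
    move=> h; case: i i0 iq => [|[|i]]// _ iq; [left|right].
      by move=> _ [z /h hz <-]; exact: rho_neg_arc.
    by move=> _ [z /h hz <-]; exact: iter_rho_neg_arc.
  split; first by have := arcs _ IH1; rewrite image_setU !image_set1.
  rewrite -image_comp; case: IH2 => [->|/arcs[h|h]].
  + by apply: Or31; exact: iter_rho_base_polygon.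
  + by apply: Or32.
  + by apply: Or33.
- have arcs (X : set (Rinf R)) : X `<=` far_arc \/ X `<=` mid_arc ->
      sigma @` X `<=` neg_arc.
    by move=> [h|h] _ [z /h hz <-]; apply: (sigma_neg_arc hq); [left|right].
  split; first by have := arcs _ IH1; rewrite image_setU !image_set1.
  right; rewrite -image_comp; case: IH2 => [->|h|h]; [|apply: arcs; left|apply: arcs; right] => //.
  move=> _ [z /(base_polygonP hq) [->|h] <-].
    by rewrite /neg_arc /= lexx.
  by apply: (sigma_neg_arc hq); right.
Qed.

Lemma farey_adj_arc u v : farey_adj q u v -> in_one_arc [set u; v].
Proof.
move=> [g /hecke_has_syllables [b /syllables_arc h] ->].
case: b h => -[h _]; last exact: Or31.
by case: h => h; [exact: Or32|exact: Or33].
Qed.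

Lemma farey_face_arc P : farey_face q P -> P = E \/ in_one_arc P.
Proof.
move=> [g /hecke_has_syllables [b /syllables_arc h] <-].
case: b h => -[_]; last by case=> h; [left|right; exact: Or31].
by case=> h; [left|right; exact: Or32|right; exact: Or33].
Qed.

End NormalForm.

(** * Neighbourhoods of infinity and continuity of the action *)

Section Topology.
Variables (R : realType) (q : nat).

Local Notation lam := (hecke_lambda R q).
Local Notation oo := (infty R).
Local Notation sigma := (@sigma R).
Local Notation tau := (@tau R q).

(** Neighbourhoods of infinity contain complements of closed compact sets; such sets are bounded,
    and conversely [-M, M] is one of them. *)
Lemma nbhs_ooP (U : set (Rinf R)) : nbhs oo U <->
  U oo /\ exists M, forall t, M < `|t| -> U (Some t).
Proof.
split=> [|[U0 [M hM]]].
  move=> [K [cK _] KU]; split; first by apply: KU; right.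
  have [M [_ hM]] := compact_bounded cK.
  exists (M + 1) => t ht; apply: KU; left; exists t => // Kt.
  by move: ht; rewrite ltNge hM// ltrDl.
exists `[- M, M]%classic.
  by split; [exact: segment_compact|exact: interval_closed].
move=> z [[t nt <-]|-> //]; apply: hM; rewrite ltNge; apply/negP => h.
by apply: nt; rewrite /= in_itv/= -ler_norml.
Qed.

Lemma sigma_continuous : continuous sigma.
Proof.
case=> [t|] U.
  have [->|t0] := eqVneq t 0.
    rewrite /Defs.sigma eqxx => /nbhs_ooP[U0 [M hM]].
    have M0 : 0 < `|M| + 1 by rewrite ltr_wpDl.
    (* With this radius every nonzero s in the ball has |1/s| > |M| + 1 > M; adding 1 keeps the
       radius well defined when M = 0. *)
    apply/nbhs_ballP; exists (`|M| + 1)^-1; rewrite /= ?invr_gt0// => s /=.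
    rewrite /ball /= sub0r normrN => hs; case: ifPn => [//|s0].
    apply: hM; rewrite normrN normfV (le_lt_trans (ler_norm M))//.
    rewrite -[X in X < _]addr0 (@lt_trans _ _ (`|M| + 1)) ?ltrD2l//.
    by rewrite -[X in X < _]invrK ltf_pV2// posrE ?invr_gt0// normr_gt0.
  rewrite {1}/Defs.sigma (negbTE t0) => hU.
  have : \forall s \near t, s != 0 /\ U (Some (- s^-1)).
    near=> s; split; first by near: s; exact: open_neq.
    near: s; have c : {for t, continuous (fun s : R => - s^-1)}.
      by apply: continuousN; exact: inv_continuous.
    exact: c hU.
  by apply: filterS => s /= [s0 Us]; rewrite (negbTE s0).
move=> /nbhs_ballP[e /= e0 he]; apply/nbhs_ooP; split.
  by apply: he; exact: ballxx.
exists e^-1 => t ht; have t0 : t != 0.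
  by rewrite -normr_gt0 (lt_trans _ ht)// invr_gt0.
rewrite /= (negbTE t0); apply: he.
rewrite /ball /= sub0r opprK normfV -[X in _ < X]invrK ltf_pV2// posrE ?invr_gt0//.
by rewrite normr_gt0.
Unshelve. all: by end_near. Qed.

(** Any real shift is allowed: besides integer powers of [tau], recentring at an arbitrary point is
    needed in [connected_to_oo]. *)
Definition translation (c : R) (z : Rinf R) : Rinf R :=
  if z is Some t then Some (t + c) else None.

Lemma translation_continuous c : continuous (translation c).
Proof.
case=> [t|] U hU.
  have h : {for t, continuous (fun s : R => s + c)}.
    by apply: continuousD => //; exact: cst_continuous.
  exact: h hU.
move/nbhs_ooP: hU => [U0 [M hM]]; apply/nbhs_ooP; split=> //.
exists (M + `|c|) => t ht; apply: hM.
have := ler_normD (t + c) (- c); rewrite addrK normrN; lra.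
Qed.

Lemma hecke_homeo (g : Rinf R -> Rinf R) : hecke q g -> exists h,
  [/\ hecke q h, cancel g h, cancel h g, continuous g & continuous h].
Proof.
have hs : @hecke R q sigma by apply: generated_gen; left.
have ht : @hecke R q tau by apply: generated_gen; right.
elim=> {g} [f [->|->]||f f' _ [h [h1 h2 h3 h4 h5]] _ [k [k1 k2 k3 k4 k5]]
  |f f' hf [h [h1 h2 h3 h4 h5]] ff' f'f].
- exists sigma; split=> //; by [exact: sigma_sigma|exact: sigma_continuous].
- have K1 : cancel tau (translation (- lam)) by case=> //= t; rewrite addrK.
  have K2 : cancel (translation (- lam)) tau by case=> //= t; rewrite subrK.
  exists (translation (- lam)); split=> //.
  + exact: generated_inv ht _ _.
  + exact: translation_continuous.
  + exact: translation_continuous.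
- by exists idfun; split=> //; first exact: generated_id; move=> z U.
- exists (k \o h); split.
  + exact: generated_comp.
  + exact: can_comp.
  + exact: can_comp.
  + by move=> z; apply: continuous_comp; [exact: k4|exact: h4].
  + by move=> z; apply: continuous_comp; [exact: h5|exact: k5].
- exists f; split=> //; rewrite (_ : f' = h)//; apply/funext => z.
  by rewrite -[in LHS](h3 z) ff'.
Qed.

(** The ray from t to infinity pointing away from c works. It shows that removing points not on the
    side of c containing t cannot separate t from infinity. *)
Lemma connected_to_oo (c t : R) : t != c -> exists C : set (Rinf R),
  [/\ connected C, C oo, C (Some t) &
      forall s, C (Some s) -> 0 < (s - c) * (t - c)].
Proof.
rewrite -subr_eq0 => tc0.
(* This is r |-> c + (t - c)/r, with f(0) infinite and f(1) = t; writing it through [sigma] gives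
   continuity at r = 0. *)
pose f (r : R) : Rinf R := translation c (sigma (Some (- (r / (t - c))))).
exists (f @` `[0, 1]); split.
- apply: connected_continuous_connected.
    exact/connected_intervalP/interval_is_interval.
  apply: continuous_subspaceT => s.
  have c0 : {for s, continuous (fun r : R => - (r / (t - c)))}.
    by apply: continuousN; apply: continuousM => //; exact: cst_continuous.
  have c1 : {for s, continuous (fun r : R => Some (- (r / (t - c))) : Rinf R)}.
    exact: (continuous_comp c0 (@one_point_compactification_some_continuous _ _)).
  have c2 := continuous_comp c1 (@sigma_continuous _).
  exact: (continuous_comp c2 (@translation_continuous c _)).
- by exists 0; rewrite /f /= ?mul0r ?oppr0 ?eqxx// in_itv/= lexx ler01.
- exists 1; first by rewrite /= in_itv/= lexx ler01.
  by rewrite /f /= mul1r oppr_eq0 invr_eq0 (negbTE tc0)/= invrN opprK invrK subrK.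
- move=> s [r + ]; rewrite /f /= in_itv/= => /andP[r0 r1].
  case: ifPn => //= rn0 [<-]; move: rn0.
  rewrite oppr_eq0 mulf_eq0 invr_eq0 (negbTE tc0) orbF => rn0.
  rewrite addrK invrN opprK invfM invrK -mulrA -expr2 mulr_gt0//.
    by rewrite invr_gt0 lt_def rn0.
  by rewrite exprn_even_gt0.
Qed.

End Topology.

(** * Parent faces, transport by the group, and path crossing *)

Section Parents.
Variables (R : realType) (q : nat).
Hypothesis hq : (3 <= q)%N.

Local Notation lam := (hecke_lambda R q).
Local Notation oo := (infty R).
Local Notation O := (Defs.zero R).
Local Notation E := (@base_polygon R q).

Lemma farey_adj_image g (u v : Rinf R) :
  hecke q g -> farey_adj q u v -> farey_adj q (g u) (g v).
Proof.
move=> hg [f hf uv]; exists (g \o f); first exact: generated_comp.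
by have := congr1 (image ^~ g) uv; rewrite /= !image_setU !image_set1.
Qed.

Lemma farey_adj_neq (u v : Rinf R) : farey_adj q u v -> u <> v.
Proof.
move=> [g /hecke_homeo[h [_ gK _ _ _]] e] uv; move: e; rewrite uv setUid => e.
have e0 : g O = v by have : [set v] (g O) by rewrite e; left.
have e1 : g oo = v by have : [set v] (g oo) by rewrite e; right.
by have := gK O; rewrite e0 -e1 gK.
Qed.

Lemma farey_path_image g (x y : Rinf R) s : hecke q g ->
  farey_path q x s y -> farey_path q (g x) (map g s) (g y).
Proof.
move=> hg [ps <-]; split; last by rewrite last_map.
elim: s x ps => //= v s IH x /andP[/asboolP xv /IH ->]; rewrite andbT.
exact/asboolP/farey_adj_image.
Qed.

(** Elements of G_q are homeomorphisms preserving faces and adjacency, so they carry components to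
    components; this permits moving x to infinity. *)
Lemma parent_face_image g (x y : Rinf R) P : hecke q g ->
  parent_face q y x P -> parent_face q (g y) (g x) (g @` P).
Proof.
move=> hg; have [h [hh gK hK gc hc]] := hecke_homeo hg.
move=> [[f hf fP] Px [u [v [uv Puv yuv ncc]]]]; split.
- exists (g \o f); first exact: generated_comp.
  by rewrite -image_comp fP.
- by exists x.
have preim : ~` [set g u; g v] = h @^-1` ~` [set u; v].
  apply/seteqP; split=> z /= nz [] e; apply: nz.
  + by left; rewrite -e hK.
  + by right; rewrite -e hK.
  + by left; rewrite e gK.
  + by right; rewrite e gK.
exists (g u), (g v); split.
- by move=> /(congr1 h); rewrite !gK.
- have -> : [set g u; g v] = g @` [set u; v] by rewrite image_setU !image_set1.
  rewrite -Puv; apply/seteqP; split=> [_ [[w Pw <-] xw]|_ [w [Pw xw] <-]].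
    by exists w => //; split=> //; have := farey_adj_image hh xw; rewrite !gK.
  by split; [exists w|exact: farey_adj_image].
- by rewrite preim /= gK.
- move=> [C [Cy Csub Cc] Cx]; apply: ncc; exists (h @` C); last by exists (g x).
  split; first by exists (g y).
    by move=> _ [z /Csub + <-]; rewrite preim.
  apply: connected_continuous_connected => //.
  exact: continuous_subspaceT.
Qed.

Lemma closed_mid_arc : closed (@mid_arc R q).
Proof.
rewrite -openC openE => -[t|] nz; last first.
  apply/nbhs_ooP; split=> //; exists lam => t ht /= /andP[t0 tl].
  by move: ht; rewrite ger0_norm// ltNge tl.
have h : nbhs t (~` `[0, lam]%classic).
  apply: open_nbhs_nbhs; split; first exact/closed_openC/interval_closed.
  by move=> /=; rewrite in_itv.
by apply: filterS h => s /=; rewrite in_itv.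
Qed.

Lemma parent_face_base (t : R) : 0 < t < lam -> parent_face q (Some t) oo E.
Proof.
move=> /andP[t0 tl]; have l0 := hecke_lambda_gt0 R hq.
have adj0 : farey_adj q oo O by exists idfun; [exact: generated_id|rewrite setUC].
have adjl : farey_adj q oo (Some lam).
  exists (@tau R q); first by apply: generated_gen; right.
  by rewrite setUC /= add0r.
split; first by exists idfun; [exact: generated_id|exact: image_id].
  exact: base_polygon_oo.
exists O, (Some lam); split.
- by case=> e; move: l0; rewrite -e ltxx.
- apply/seteqP; split=> z; last first.
    by case=> ->; split=> //; [exact: base_polygon_zero|exact: base_polygon_lambda].
  (* A finite vertex of [E] lies in [0, lambda_q], while an edge at infinity lies in the negative or
     far arc; these meet only in 0 and lambda_q. *)
  move=> [Ez xz]; have zoo := farey_adj_neq xz.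
  case: (base_polygonP hq Ez) => [zE|mz]; first by case: zoo.
  have h := farey_adj_arc hq xz; case: z mz h {Ez xz zoo} => [s|]// /andP[s0 sl] h.
  case: h => [/(_ (Some s))|/(_ (Some s))|/(_ oo)] /= h.
  + by left; congr Some; apply/eqP; rewrite eq_le s0 h//; right.
  + by right; congr Some; apply/eqP; rewrite eq_le sl h//; right.
  + by case: h; left.
- by case=> -[e]; [move: t0|move: tl]; rewrite e ltxx.
- move=> [C [Ct Csub Cc] Coo].
  (* Off its endpoints this interval is both open and the trace of the closed middle arc, so a
     connected set containing t cannot leave it. *)
  pose A : set (Rinf R) := Some @` `]0, lam[%classic.
  suff CA : C `&` A = C by move: Coo; rewrite -CA => -[_ []].
  apply: Cc; first by exists (Some t); split=> //; exists t; rewrite //= in_itv/= t0.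
  - exists A => //; apply: one_point_compactification_open_some.
    exact: interval_open.
  - exists (@mid_arc R q); first exact: closed_mid_arc.
    apply/seteqP; split=> z [Cz Az]; split=> //.
      by case: Az => s /=; rewrite in_itv/= => /andP[s0 sl] <-; rewrite /mid_arc/= !ltW.
    case: z Cz Az => [s|]// /Csub ns /andP[s0 sl]; exists s => //=.
    rewrite in_itv/= !lt_neqAle s0 sl !andbT; apply/andP; split; apply/eqP => e; apply: ns.
      by left; rewrite -e.
    by right; rewrite e.
Qed.

(** Separating t from infinity requires one of u, v above 0 and one below lambda_q. A face other
    than [E] lies in one arc: the negative and far arcs violate these bounds, and the middle arc
    misses infinity. *)
Lemma parent_face_unique (t : R) P : 0 < t < lam ->
  parent_face q (Some t) oo P -> P = E.
Proof.
move=> /andP[t0 tl]; have l0 := hecke_lambda_gt0 R hq.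
move=> [Pf Poo [u [v [uv Puv _ ncc]]]].
have [Pu xu] : P u /\ farey_adj q oo u by have : [set u; v] u; [left|rewrite -Puv].
have [Pv xv] : P v /\ farey_adj q oo v by have : [set u; v] v; [right|rewrite -Puv].
have sides w : farey_adj q oo w -> exists2 s, w = Some s & s <= 0 \/ lam <= s.
  move=> xw; have wn := farey_adj_neq xw.
  case: w xw wn => [s|]// xw _; exists s => //.
  case: (farey_adj_arc hq xw) => [/(_ (Some s))|/(_ (Some s))|/(_ oo)] /= h.
  - by left; apply: h; right.
  - by right; apply: h; right.
  - by case: h; left.
have [a ua ha] := sides _ xu; have [b vb hb] := sides _ xv.
subst u v.
(* Otherwise the ray of [connected_to_oo] avoids both neighbours and joins t to infinity. It is
   applied with c = 0 and c = lambda_q. *)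
have not_same c : t != c -> 0 < (a - c) * (t - c) \/ 0 < (b - c) * (t - c).
  move=> tc; have [C [Cc Coo Ct Cs]] := connected_to_oo tc.
  have [|na] := pselect (C (Some a)); first by left; exact: Cs.
  have [|nb] := pselect (C (Some b)); first by right; exact: Cs.
  by case: ncc; exists C => //; split=> // z Cz [] e; move: Cz; rewrite e.
have [//|h] := farey_face_arc hq Pf.
have t_neq0 : t != 0 by rewrite gt_eqF.
have t_neql : t != lam by rewrite lt_eqF.
have h0 : 0 < a \/ 0 < b.
  by case: (not_same 0 t_neq0); rewrite !subr0 pmulr_lgt0// => ?; [left|right].
have hl : a < lam \/ b < lam.
  by case: (not_same lam t_neql); rewrite nmulr_lgt0 ?subr_lt0// => ?; [left|right].
exfalso; case: h => h; last by case: (h _ Poo).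
  by move: (h _ Pu) (h _ Pv); rewrite /neg_arc/=; lra.
by move: (h _ Pu) (h _ Pv); rewrite /far_arc/=; lra.
Qed.

(** Consider the first step into the open arc (0, lambda_q). Its edge lies in the closed middle arc,
    so the vertex just before entry is an endpoint. *)
Lemma farey_path_crosses (x : Rinf R) s (t : R) : 0 < t < lam ->
  farey_path q x s (Some t) ->
  (if x is Some r then ~~ (0 < r < lam) else true) ->
  O \in x :: s \/ Some lam \in x :: s.
Proof.
move=> ht; elim: s x => [|v s IH] x [/= ps ls] nx.
  by move: nx; rewrite ls ht.
move: ps => /andP[/asboolP xv ps].
have [vi|nvi] := boolP (if v is Some r then 0 < r < lam else false); last first.
  have [||h|h] := IH v; first by split.
  - by case: v nvi {xv ps ls}.
  - by left; rewrite inE h orbT.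
  - by right; rewrite inE h orbT.
case: v vi xv {ps ls} => [r|]// /andP[r0 rl] xv.
have : mid_arc q x.
  case: (farey_adj_arc hq xv) => h.
  - by move: (h (Some r) (or_intror erefl)); rewrite /neg_arc/=; lra.
  - by move: (h (Some r) (or_intror erefl)); rewrite /far_arc/=; lra.
  - by apply: h; left.
case: x nx {xv} => [w|]//= + /andP[w0 wl].
rewrite negb_and -!leNgt => /orP[h|h]; [left|right];
  by rewrite inE; apply/orP; left; apply/eqP; congr Some; lra.
Qed.

Lemma hecke_translation (k : int) : hecke q (translation (k%:~R * lam)).
Proof.
have nat_case n : hecke q (translation (n%:R * lam)).
  elim: n => [|n IH].
    rewrite (_ : translation _ = idfun); first exact: generated_id.
    by apply/funext => -[t|]//=; rewrite mul0r addr0.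
  rewrite (_ : translation _ = @tau R q \o translation (n%:R * lam)).
    by apply: generated_comp IH; apply: generated_gen; right.
  by apply/funext => -[t|]//=; congr Some; rewrite -[n.+1]addn1 natrD; ring.
case: k => n; first exact: nat_case.
apply: (generated_inv (nat_case n.+1)) => -[t|]//=; congr Some; rewrite NegzE rmorphN mulNr.
  by rewrite addrK.
by rewrite subrK.
Qed.

Lemma hecke_normalize (x y : Rinf R) : farey_vertex q x -> x <> y ->
  exists2 g, hecke q g & g x = oo /\ exists2 t, g y = Some t & 0 <= t < lam.
Proof.
move=> [g hg gx] xy; have [h [hh gK hK _ _]] := hecke_homeo hg.
have l0 := hecke_lambda_gt0 R hq.
case hy : (h y) => [s|]; last first.
  by case: xy; rewrite -gx -[y]hK hy.
(* Translating by -k lambda_q fixes infinity and reduces s modulo lambda_q. *)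
pose k := Num.floor (s / lam).
exists (translation ((- k)%:~R * lam) \o h).
  by apply: generated_comp => //; exact: hecke_translation.
split; first by rewrite /= -gx gK.
exists (s - k%:~R * lam); first by rewrite /= hy rmorphN mulNr.
have /andP[k1 k2] := Num.Theory.floor_itv (s / lam).
rewrite subr_ge0 -ler_pdivlMr// k1/= ltrBlDr.
by move: k2; rewrite ltr_pdivrMr// intrD mulrDl mul1r addrC.
Qed.


Lemma far_path_meets_parents (x y : Rinf R) s : farey_vertex q x ->
  ~ (x = y \/ farey_adj q x y) -> farey_path q x s y ->
  exists2 p, p \in x :: s & parents q y x p.
Proof.
move=> vx nxy xsy; have xy : x <> y by move=> e; apply: nxy; left.
have [g hg [gx [t gy /andP[t0 tl]]]] := hecke_normalize vx xy.
have [h [hh gK hK _ _]] := hecke_homeo hg.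
(* The value t = 0 is excluded because 0 is adjacent to infinity, which would make x and y
   adjacent. *)
have tpos : 0 < t < lam.
  rewrite tl lt_def t0 !andbT; apply/eqP => te; apply: nxy; right.
  rewrite -[x]gK -[y]gK gx gy te; apply: farey_adj_image => //.
  by exists idfun; [exact: generated_id|rewrite setUC].
have hEg (P : set (Rinf R)) : h @` (g @` P) = P.
  by rewrite image_comp (_ : h \o g = idfun) ?image_id//; exact/funext.
have faceE : parent_face q y x (h @` E).
  rewrite -[y]gK -[x]gK gx gy; apply: parent_face_image => //.
  exact: parent_face_base.
(* The image under [g] of any other candidate is a parent face at infinity, hence [E]; applying [h]
   recovers the candidate. *)
have uniqE : unique (parent_face q y x) (h @` E).
  split=> // P /(parent_face_image hg); rewrite gx gy => /(parent_face_unique tpos) <-.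
  exact: hEg.
have parent z : E z -> farey_adj q oo z -> z \in oo :: map g s ->
    exists2 p, p \in x :: s & parents q y x p.
  move=> Ez adj zs; exists (h z).
    by move: (map_f h zs); rewrite /= (mapK gK) -gx gK.
  right; split=> //; exists (h @` E); split; [exact: uniqE|by exists z|].
  by rewrite -[x]gK gx; exact: farey_adj_image.
have := farey_path_image hg xsy; rewrite gx gy => /(farey_path_crosses tpos) /(_ isT).
case=> [zs|zs]; apply: parent zs.
- exact: base_polygon_zero.
- by exists idfun; [exact: generated_id|rewrite setUC].
- exact: base_polygon_lambda.
- exists (@tau R q); first by apply: generated_gen; right.
  by rewrite setUC /= add0r.
Qed.

End Parents.

Theorem theorem6 (R : realType) (q : nat) (hq : (3 <= q)%N)
    (x y : Rinf R) (hx : farey_vertex q x) (hy : farey_vertex q y)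
    (s : seq (Rinf R)) (hs : farey_path q x s y) :
  exists2 p, p \in x :: s & parents q y x p.
Proof.
have [xy|nxy] := pselect (x = y \/ farey_adj q x y).
  by exists y; [case: hs => _ <-; exact: mem_last|left].
exact: far_path_meets_parents.
Qed.
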